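(* If $G$ is a planar graph with girth at least $5$, or if $G$ is a graph with $\mathrm{mad}(G)<3$, then $a_\ell(G)\le6$.
   Context: Graphs are finite and simple; the girth is the length of a shortest cycle, and $\mathrm{mad}(G)=\max_{H\subseteq G}\frac{2|E(H)|}{|V(H)|}$ over nonempty subgraphs $H$. An acyclic coloring is a proper vertex coloring in which no cycle receives only two colors (the union of any two color classes induces a forest). $a_\ell(G)$ is the least $k$ such that for every assignment of lists of size $k$ to the vertices there is an acyclic coloring choosing each vertex's color from its list. *)

(* Defs.v *)
From HB Require Import structures.
From mathcomp Require Import all_boot all_order all_algebra.
From mathcomp Require Import finmap.
From mathcomp Require Import all_classical all_reals.

Set Implicit Arguments.
Unset Strict Implicit.
Unset Printing Implicit Defensive.

Import Order.TTheory GRing.Theory Num.Theory.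

Record sgraph := SGraph {
  vertex :> finType;
  adj : rel vertex;
  adj_sym : symmetric adj;
  adj_irrefl : irreflexive adj }.

Definition edges (G : sgraph) : {set {set G}} :=
  [set E : {set G} | [exists u, exists v, adj u v && (E == [set u; v]%SET)]].

Definition is_cycle (G : sgraph) (s : seq G) : bool :=
  (2 < size s) && ucycleb (@adj G) s.

(* A forest has infinite girth, hence girth at least k for every k. *)
Definition girth_at_least (k : nat) (G : sgraph) : Prop :=
  forall s : seq G, is_cycle s -> k <= size s.

(* A pair (W, F) stands for the subgraph with vertex set W and edge set F. *)
Definition is_subgraph (G : sgraph) (H : {set G} * {set {set G}}) : bool :=
  (H.2 \subset edges G) && [forall E in H.2, E \subset H.1].

(* The densities are nonnegative, so the default value 0 matters only for the
   graph with no vertex. *)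
Definition mad (G : sgraph) : rat :=
  \big[Num.max/0%R]_(H : {set G} * {set {set G}} |
                      is_subgraph H && (H.1 != finset.set0))
    ((2 * #|H.2|)%:R / #|H.1|%:R)%R.

Definition proper_coloring (G : sgraph) (c : G -> nat) : Prop :=
  forall u v : G, adj u v -> c u != c v.

Definition acyclic_coloring (G : sgraph) (c : G -> nat) : Prop :=
  proper_coloring c /\
  forall (s : seq G) (a b : nat),
    is_cycle s -> ~~ all (fun v => (c v == a) || (c v == b)) s.

Definition acyclically_choosable (G : sgraph) (k : nat) : Prop :=
  forall L : G -> {fset nat}, (forall v, #|` L v| = k) ->
  exists2 c : G -> nat, (forall v, c v \in L v) & acyclic_coloring c.

Lemma injective_acyclic (G : sgraph) (c : G -> nat) :
  injective c -> acyclic_coloring c.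
Proof.
move=> ci; split=> [u v uv|s a b].
  by apply/negP => /eqP/ci uv'; move: uv; rewrite uv' adj_irrefl.
case/andP=> s3 /andP[_ us]; apply/negP => /allP h.
have : size (map c s) <= size [:: a; b].
  apply: uniq_leq_size; first by rewrite map_inj_uniq.
  by move=> _ /mapP[v vs ->]; rewrite !inE; exact: h.
by rewrite size_map leqNgt s3.
Qed.

Lemma distinct_representatives (T : eqType) (L : T -> {fset nat}) (s : seq T) :
  uniq s -> (forall v, size s <= #|` L v|) ->
  exists2 c : T -> nat, {in s, forall v, c v \in L v} & {in s &, injective c}.
Proof.
elim: s => [|x s IH] /=; first by exists (fun=> 0).
case/andP=> xs us hL.
have [c cL ci] := IH us (fun v => leq_trans (leqnSn _) (hL v)).
have [y yL ys] : exists2 y, y \in L x & y \notin map c s.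
  apply/hasP; apply: contraT => /hasPn h.
  have : size (L x : seq nat) <= size (map c s).
    apply: uniq_leq_size; first exact: fset_uniq.
    by move=> y /h; rewrite negbK.
  by rewrite size_map leqNgt (hL x).
exists (fun v => if v == x then y else c v).
  move=> v; rewrite inE; case: eqP => [-> //|_ /=]; exact: cL.
have ny v : v \in s -> c v <> y.
  by move=> vs E; move: ys; rewrite -E map_f.
move=> u v; rewrite !inE; case: eqP => [->|_] /=; case: eqP => [->|_] //=.
- by move=> _ vs /esym/(ny _ vs).
- by move=> us' _ /(ny _ us').
- exact: ci.
Qed.

Lemma acyclically_choosable_ex (G : sgraph) :
  exists k, `[< acyclically_choosable G k >].
Proof.
exists #|G|; apply/asboolP => L hL.
have [||c cL ci] := @distinct_representatives G L (enum G).
- exact: enum_uniq.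
- by move=> v; rewrite -cardE hL.
exists c => [v|]; first by apply: cL; rewrite mem_enum.
by apply: injective_acyclic => u v; apply: ci; rewrite mem_enum.
Qed.

(* The acyclic list chromatic number. *)
Definition acyclic_list_number (G : sgraph) : nat :=
  ex_minn (acyclically_choosable_ex G).

(* A planar graph is one with a crossing-free drawing in the plane; as in the
   textbooks of Diestel and of West, the edges are drawn as polygonal curves. *)
Local Open Scope ring_scope.
Local Open Scope classical_set_scope.

Definition segment (R : realType) (p q : 'rV[R]_2) : set 'rV[R]_2 :=
  [set x | exists2 t : R, 0 <= t <= 1 & x = (1 - t) *: p + t *: q].

(* The union of the segments joining consecutive points of p :: s. *)
Fixpoint polyline (R : realType) (p : 'rV[R]_2)
    (s : seq 'rV[R]_2) : set 'rV[R]_2 :=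
  if s is q :: s' then segment p q `|` polyline q s' else [set p].

(* No repeated point: every segment is nondegenerate and meets the part of the
   curve that follows it only at the shared end. *)
Fixpoint simple_polyline (R : realType) (p : 'rV[R]_2)
    (s : seq 'rV[R]_2) : Prop :=
  if s is q :: s' then
    [/\ p != q, segment p q `&` polyline q s' `<=` [set q]
      & simple_polyline q s']
  else True.

Definition polygonal_arc (R : realType) (p q : 'rV[R]_2)
    (A : set 'rV[R]_2) : Prop :=
  exists s, [/\ last p s = q, simple_polyline p s & A = polyline p s].

(* The last two conditions say that the interior of an edge contains no vertex
   and no point of another edge. *)
Definition plane_drawing (R : realType) (G : sgraph)
    (pos : G -> 'rV[R]_2) (curve : {set G} -> set 'rV[R]_2) : Prop :=
  [/\ injective pos,
      forall u v : G, adj u v ->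
        polygonal_arc (pos u) (pos v) (curve [set u; v]%SET),
      forall (E : {set G}) (w : G),
        E \in edges G -> curve E (pos w) -> w \in E
    & forall (E F : {set G}) x, E \in edges G -> F \in edges G -> E != F ->
        curve E x -> curve F x ->
        exists2 w : G, w \in E :&: F & x = pos w].

Definition planar (R : realType) (G : sgraph) : Prop :=
  exists (pos : G -> 'rV[R]_2) (curve : {set G} -> set 'rV[R]_2),
    plane_drawing pos curve.

(* Main.v *)
Require Import Defs.
From mathcomp Require Import all_boot all_order all_algebra.
From mathcomp Require Import finmap.
From mathcomp Require Import all_classical all_reals.
From mathcomp Require Import zify ring lra.

(* Induct on the vertex set. A vertex of degree at most 1, a 2-vertex with a
   neighbour of degree at most 5, and a 3-vertex with two 3-neighbours can be
   coloured last, since at most five colours are forbidden for it. So suppose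
   that none of them occurs. If mad(G) < 3, every 2-vertex takes 1/2 from each
   of its neighbours, which have degree at least 6, and all degrees become at
   least 3. If G is planar of girth at least 5, give the vertices of degree 2,
   3, 4-5, >= 6 the weights g = 0, 2, 3, 4: every cycle has weight at least 12,
   while d (6 - g) >= 12 at every vertex of degree d.

   The planar case then needs E - V + 1 nonempty even edge sets covering each
   edge at most twice (each of them contains a cycle), and these are obtained
   without faces. Label the edges by vectors over F_2, the coordinates of the
   cycle space, so that the labels at each vertex sum to 0 and span a space of
   dimension at least E - V + 1. For a segment of the drawing let U be the sum
   of the labels of the segments above it; it does not depend on where along
   the segment one looks, because the labels at a vertex cancel. The two sides
   of an edge with label l carry the values U and U + l. For a fixed nonzero
   value c, the edges with c on exactly one side form an even set, and the
   values c that occur span the space of the labels. *)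

Set Implicit Arguments.
Unset Strict Implicit.
Unset Printing Implicit Defensive.
Import Order.TTheory GRing.Theory Num.Theory.
Local Open Scope ring_scope.

(** * Arrangements of non-crossing segments *)

Section Telescope.

Variables (R : realFieldType) (I : finType) (V : zmodType).
Variables (key : I -> R) (lam : I -> V).

(** In decreasing order of the keys the partial sums form a walk from [T] to [T] plus the sum of all
    labels. A summand is true when that step of the walk enters or leaves [c], so modulo 2 only the
    two ends of the walk matter. *)
Lemma telescope_flips (S : {set I}) (T c : V) : {in S &, injective key} ->
  \big[addb/false]_(i in S)
     ((T + \sum_(j in S | key i < key j) lam j == c)
      (+) (T + \sum_(j in S | key i < key j) lam j + lam i == c))
  = (T == c) (+) (T + \sum_(j in S) lam j == c).
Proof.
move: {2}#|S| (erefl #|S|) => n; elim: n S => [|n IH] S cardS inj.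
  move/eqP: cardS; rewrite cards_eq0 => /eqP ->.
  by rewrite !finset.big_set0 addr0 addbb.
have /card_gt0P[i1 i1S] : (0 < #|S|)%N by rewrite cardS.
(* The least key is the last step of the walk: its partial sum contains all other labels, and its
   own label occurs in no other partial sum. *)
case: (arg_minP key i1S) => i0 i0S' min0; have i0S : i0 \in S := i0S'.
have cardS' : #|S :\ i0| = n by apply: succn_inj; rewrite -cardS (cardsD1 i0 S) i0S.
rewrite (big_setD1 i0) //= [in RHS](big_setD1 i0) //=.
have -> : \sum_(j in S | key i0 < key j) lam j = \sum_(j in S :\ i0) lam j.
  apply: eq_bigl => j; rewrite !inE lt_neqAle andbC.
  case jS: (j \in S); rewrite ?andbF //= min0 // !andbT.
  by congr negb; apply/eqP/eqP => [/inj -> //|->].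
have -> : \big[addb/false]_(i in S :\ i0)
     ((T + \sum_(j in S | key i < key j) lam j == c)
      (+) (T + \sum_(j in S | key i < key j) lam j + lam i == c)) =
   (T == c) (+) (T + \sum_(j in S :\ i0) lam j == c).
  rewrite -IH //; last by move=> i j /setD1P[_ iS] /setD1P[_ jS]; apply: inj.
  apply: eq_bigr => i /setD1P[_ iS].
  suff -> : \sum_(j in S | key i < key j) lam j =
            \sum_(j in S :\ i0 | key i < key j) lam j by [].
  apply: eq_bigl => j; rewrite !inE.
  by case: eqP => [->|_] //=; rewrite ltNge min0 // andbF.
rewrite [lam i0 + _]addrC addrA.
by case: (T == c); case: (T + _ == c); case: (T + _ + _ == c).
Qed.

End Telescope.

(** * Segments directed from left to right, and the values on their two sides *)

Section Arrangement.

Variables (R : realFieldType) (N I : finType) (px py : N -> R) (a b : I -> N).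
Hypothesis px_inj : injective px.
Hypothesis lt_ab : forall i, px (a i) < px (b i).

Definition slope i := (py (b i) - py (a i)) / (px (b i) - px (a i)).
Definition height i x := py (a i) + (x - px (a i)) * slope i.

Hypothesis noncrossing : forall i j x, i != j ->
  px (a i) <= x <= px (b i) -> px (a j) <= x <= px (b j) ->
  height i x = height j x -> x = px (a j) \/ x = px (b j).

Definition inside i x := px (a i) < x < px (b i).
(** The middle of the common range of abscissas serves as the one place where two segments are
    compared, which makes [above] a boolean; [above_point] frees the comparison from this choice. *)
Definition mid i j :=
  (Num.max (px (a i)) (px (a j)) + Num.min (px (b i)) (px (b j))) / 2.
Definition overlap i j := (px (a i) < px (b j)) && (px (a j) < px (b i)).
Definition above j i := overlap i j && (height i (mid i j) < height j (mid i j)).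

Lemma overlapC i j : overlap i j = overlap j i.
Proof. by rewrite /overlap andbC. Qed.

Lemma midC i j : mid i j = mid j i.
Proof. by rewrite /mid maxC minC. Qed.

Lemma mid_inside i j : overlap i j -> inside i (mid i j).
Proof.
rewrite /overlap /inside /mid => /andP[h1 h2].
have := lt_ab i; have := lt_ab j => hj hi.
by case: (lerP (px (a i)) (px (a j))) => ?; case: (lerP (px (b i)) (px (b j))) => ?;
  apply/andP; split; lra.
Qed.

Lemma height_left i : height i (px (a i)) = py (a i).
Proof. by rewrite /height subrr mul0r addr0. Qed.

Lemma heightE i x : height i x = py (b i) + (x - px (b i)) * slope i.
Proof.
rewrite /height /slope; have := lt_ab i; rewrite -subr_gt0 => h.
field; exact: lt0r_neq0.
Qed.

Lemma height_right i : height i (px (b i)) = py (b i).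
Proof. by rewrite heightE subrr mul0r addr0. Qed.

(** The intermediate value theorem for two affine functions: their difference goes from [f] to [g]
    in size while changing sign, so it vanishes at the fraction [f / (f + g)] of the way from [u] to
    [v]. *)
Lemma height_crossing i j u v : height i u < height j u ->
  height j v < height i v ->
  exists z, [/\ height i z = height j z, Num.min u v <= z & z <= Num.max u v].
Proof.
move=> hu hv; set f := height j u - height i u; set g := height i v - height j v.
have f0 : 0 < f by rewrite subr_gt0.
have g0 : 0 < g by rewrite subr_gt0.
have fg1 : 0 < f + g by apply: addr_gt0.
have fg0 : f + g != 0 by rewrite gt_eqF.
set s := f / (f + g).
have s0 : 0 <= s by apply: divr_ge0; [|apply: addr_ge0]; apply: ltW.
have s1 : s <= 1 by rewrite ler_pdivrMr // mul1r lerDl ltW.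
exists (u + (v - u) * s); split.
- apply/eqP; rewrite -subr_eq0; apply/eqP.
  have -> : height i (u + (v - u) * s) - height j (u + (v - u) * s) =
    (f + g) * s - f.
    by rewrite /f /g /height; ring.
  by rewrite /s mulrC divfK // subrr.
- by case: (lerP u v) => ?; nra.
- by case: (lerP u v) => ?; nra.
Qed.

Lemma inside_neq i x : inside i x -> x = px (a i) \/ x = px (b i) -> False.
Proof. by case/andP=> h1 h2 [] e; move: h1 h2; rewrite e ltxx. Qed.

Lemma insideW i x : inside i x -> px (a i) <= x <= px (b i).
Proof. by case/andP=> /ltW -> /ltW ->. Qed.

(** If the order at [x] differed from that at the middle, the two heights would agree in between, at
    an interior point of [j], against [noncrossing]. The point [x] may be an end of [i]; this is how
    a node is compared with a segment passing above or below it. *)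
Lemma above_point i j x : i != j -> px (a i) <= x <= px (b i) -> inside j x ->
  above i j = (height j x < height i x) /\ above j i = (height i x < height j x).
Proof.
move=> ij xi xj.
have ov : overlap i j.
  move: xi xj => /andP[h1 h2] /andP[h3 h4].
  by rewrite /overlap; apply/andP; split; lra.
rewrite /above (overlapC j i) (midC j i) ov /=.
have mi := mid_inside ov.
have mj : inside j (mid i j) by rewrite midC mid_inside // overlapC.
have ne1 : height i x != height j x.
  by apply/eqP => /(noncrossing ij xi (insideW xj))/(inside_neq xj).
have ne2 : height i (mid i j) != height j (mid i j).
  by apply/eqP => /(noncrossing ij (insideW mi) (insideW mj))/(inside_neq mj).
have no_cross u v : px (a i) <= u <= px (b i) -> inside j u ->
    px (a i) <= v <= px (b i) -> inside j v ->
    height i u < height j u -> height j v < height i v -> False.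
  move=> /andP[u1 u2] /andP[u3 u4] /andP[v1 v2] /andP[v3 v4] hu hv.
  have [z [ez z1 z2]] := height_crossing hu hv.
  have zj : inside j z.
    by move: z1 z2; rewrite /inside; case: (lerP u v) => ? ? ?; apply/andP;
      split; lra.
  have zi : px (a i) <= z <= px (b i).
    by move: z1 z2; case: (lerP u v) => ? ? ?; apply/andP; split; lra.
  exact: (inside_neq zj (noncrossing ij zi (insideW zj) ez)).
have := insideW mi => mi'.
case: (ltgtP (height i x) (height j x)) ne1 => // h1 _;
case: (ltgtP (height i (mid i j)) (height j (mid i j))) ne2 => // h2 _.
- by case: (no_cross _ _ xi xj mi' mj).
- by case: (no_cross _ _ mi' mj xi xj).
Qed.

Lemma above_irr i : above i i = false.
Proof. by rewrite /above ltxx andbF. Qed.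

Lemma above_left i j : a i = a j ->
  above j i = (slope i < slope j).
Proof.
move=> e; have ov : overlap i j.
  by have := lt_ab i; have := lt_ab j; rewrite /overlap e => -> ->.
rewrite /above ov /= /height e ltrD2l.
have /andP[] := mid_inside ov; rewrite e => h _.
by rewrite ltr_pM2l // subr_gt0.
Qed.

Lemma above_right i j : b i = b j ->
  above j i = (slope j < slope i).
Proof.
move=> e; have ov : overlap i j.
  by have := lt_ab i; have := lt_ab j; rewrite /overlap e => -> ->.
rewrite /above ov /= !heightE e ltrD2l.
have /andP[_] := mid_inside ov; rewrite e => h.
by rewrite ltr_nM2l // subr_lt0.
Qed.

Lemma slope_inj_left v : {in [set i | a i == v]%SET &, injective slope}.
Proof.
move=> i j; rewrite !inE => /eqP ai /eqP aj e; apply/eqP/negPn/negP => ij.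
have ov : overlap i j.
  by have := lt_ab i; have := lt_ab j; rewrite /overlap ai aj => -> ->.
have mi := mid_inside ov.
have mj : inside j (mid i j) by rewrite midC mid_inside // overlapC.
apply: (inside_neq mj); apply: (noncrossing ij (insideW mi) (insideW mj)).
by rewrite /height ai aj e.
Qed.

Lemma slope_inj_right v : {in [set i | b i == v]%SET &, injective slope}.
Proof.
move=> i j; rewrite !inE => /eqP ai /eqP aj e; apply/eqP/negPn/negP => ij.
have ov : overlap i j.
  by have := lt_ab i; have := lt_ab j; rewrite /overlap ai aj => -> ->.
have mi := mid_inside ov.
have mj : inside j (mid i j) by rewrite midC mid_inside // overlapC.
apply: (inside_neq mj); apply: (noncrossing ij (insideW mi) (insideW mj)).
by rewrite !heightE ai aj e.
Qed.

Variables (V : zmodType) (lam : I -> V).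
Hypothesis char2 : forall v : V, v + v = 0.
Hypothesis balanced : forall v,
  \sum_(i | a i == v) lam i + \sum_(i | b i == v) lam i = 0.

(** The half-open range selects the segments present immediately to the right of the left end of
    [i]; in [upper_right] it selects those present immediately to the left of its right end. *)
Definition upper i :=
  \sum_(j | (px (a j) <= px (a i) < px (b j)) && above j i) lam j.
Definition upper_right i :=
  \sum_(j | (px (a j) < px (b i) <= px (b j)) && above j i) lam j.
Definition over v :=
  \sum_(j | inside j (px v) && (py v < height j (px v))) lam j.

Lemma char2_eq (u v : V) : u + v = 0 -> u = v.
Proof. by move=> e; apply: (addIr v); rewrite e char2. Qed.

(** Along [i] the set of segments above changes only at nodes that lie above the interior of [i],
    and there the labels that stop and the labels that start cancel by [balanced]. *)
Lemma upperE i : upper i = upper_right i.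
Proof.
apply: char2_eq.
rewrite /upper /upper_right !(big_mkcond (fun j => _ && above j i)) -big_split /=.
(* A label counted at both ends of [i] cancels, and so does one whose segment starts and stops
   strictly between them. What remains are the starts and the stops strictly inside the range of
   [i]. *)
transitivity (\sum_(j | inside i (px (a j)) && above j i) lam j +
              \sum_(j | inside i (px (b j)) && above j i) lam j).
  rewrite !(big_mkcond (fun j => _ && above j i)) -big_split /=.
  apply: eq_bigr => j _; case ab: (above j i); rewrite ?andbF // !andbT.
  move: ab => /andP[/andP[o1 o2] _]; rewrite /inside o1 o2 !(andbT, andTb) /=.
  by case: (leP (px (a j))); case: (leP (px (b i))); rewrite ?add0r ?addr0 ?char2.
rewrite (partition_big a predT) //= [X in _ + X](partition_big b predT) //=
  -big_split /=.
rewrite big1 // => v _.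
(* If [v] lies above the interior of [i], every segment at [v] contributes and [balanced] applies;
   otherwise none does. *)
case hv: (inside i (px v) && (height i (px v) < py v)); last first.
  rewrite !big1 ?addr0 // => j /andP[/andP[h1 h2] /eqP e]; rewrite -{}e in hv.
    have ij : j != i by apply: contraTneq h2 => ->; rewrite above_irr.
    have aj : px (a j) <= px (b j) <= px (b j) by rewrite lexx ltW.
    have [e _] := above_point ij aj h1.
    by move: hv; rewrite h1 -(height_right j) -e h2.
  have ij : j != i by apply: contraTneq h2 => ->; rewrite above_irr.
  have aj : px (a j) <= px (a j) <= px (b j) by rewrite lexx ltW.
  have [e _] := above_point ij aj h1.
  by move: hv; rewrite h1 -(height_left j) -e h2.
rewrite -[RHS](balanced v); congr (_ + _); apply: eq_bigl => j.
  case: eqP => [e|_]; rewrite ?andbF // andbT.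
  case/andP: hv => h1; rewrite -e in h1 *; rewrite h1 /= => h2.
  have ij : j != i by apply: contraTneq h1 => ->; rewrite /inside ltxx.
  have aj : px (a j) <= px (a j) <= px (b j) by rewrite lexx ltW.
  by have [-> _] := above_point ij aj h1; rewrite height_left.
case: eqP => [e|_]; rewrite ?andbF // andbT.
case/andP: hv => h1; rewrite -e in h1 *; rewrite h1 /= => h2.
have ij : j != i by apply: contraTneq h1 => ->; rewrite /inside ltxx andbF.
have aj : px (a j) <= px (b j) <= px (b j) by rewrite lexx ltW.
by have [-> _] := above_point ij aj h1; rewrite height_right.
Qed.

(** Just to the right of [v], a segment above [i] either passes strictly over [v] or starts at [v]
    with a larger slope. By [px_inj] no other node has the abscissa of [v]. *)
Lemma upper_at i v : a i = v ->
  upper i = over v + \sum_(j in [set j | a j == v]%SET | slope i < slope j) lam j.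
Proof.
move=> e; rewrite /upper (bigID (fun j => a j == v)) /= addrC; congr (_ + _).
  apply: eq_bigl => j; case: eqP => [e'|ne] /=; rewrite ?andbT ?andbF.
    by rewrite /inside e' ltxx.
  have ij : i != j by apply/eqP => ij; apply: ne; rewrite -ij.
  have -> : px (a j) <= px (a i) < px (b j) = inside j (px v).
    rewrite /inside -e le_eqVlt; case: eqP => //= /px_inj.
    by rewrite e => /ne.
  case hj: (inside j (px v)) => //=; rewrite -e in hj *.
  have ai : px (a i) <= px (a i) <= px (b i) by rewrite lexx ltW.
  by have [_ ->] := above_point ij ai hj; rewrite height_left.
apply: eq_bigl => j; rewrite inE andbC; case: eqP => //= e'.
by rewrite above_left ?e // e' lexx -{1}e' lt_ab.
Qed.

Lemma upper_right_at i v : b i = v ->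
  upper_right i = over v + \sum_(j in [set j | b j == v]%SET | slope j < slope i)
    lam j.
Proof.
move=> e; rewrite /upper_right (bigID (fun j => b j == v)) /= addrC; congr (_ + _).
  apply: eq_bigl => j; case: eqP => [e'|ne] /=; rewrite ?andbT ?andbF.
    by rewrite /inside e' ltxx andbF.
  have ij : i != j by apply/eqP => ij; apply: ne; rewrite -ij.
  have -> : px (a j) < px (b i) <= px (b j) = inside j (px v).
    rewrite /inside -e le_eqVlt; case: (_ =P px (b j)) => //= /px_inj.
    by rewrite e => /esym /ne.
  case hj: (inside j (px v)) => //=; rewrite -e in hj *.
  have ai : px (a i) <= px (b i) <= px (b i) by rewrite lexx ltW.
  by have [_ ->] := above_point ij ai hj; rewrite height_right.
apply: eq_bigl => j; rewrite inE andbC; case: eqP => //= e'.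
by rewrite above_right ?e // e' lexx -{1}e' lt_ab.
Qed.

(** The upper side of [i] carries [upper i] and the lower side [upper i + lam i]; the exclusive or
    says that [c] is on exactly one side. *)
Definition bounds (c : V) i := (upper i == c) (+) (upper i + lam i == c).

(** On either side of [v], the values met from top to bottom run from [over v] to [over v] plus the
    labels on that side. By [balanced] the two walks have the same ends, and [telescope_flips] gives
    the same parity. *)
Lemma bounds_even c v :
  \big[addb/false]_(i | a i == v) bounds c i =
  \big[addb/false]_(i | b i == v) bounds c i.
Proof.
transitivity ((over v == c) (+) (over v + \sum_(j in [set i | a i == v]%SET) lam
  j == c)).
  rewrite -(telescope_flips lam _ _ (@slope_inj_left v)).
  rewrite (eq_bigl (fun i => i \in [set i | a i == v]%SET)); last by move=> i;
    rewrite inE.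
  by apply: eq_bigr => i; rewrite inE => /eqP e; rewrite /bounds (upper_at e).
have -> : \sum_(j in [set i | a i == v]%SET) lam j =
  \sum_(j in [set i | b i == v]%SET) lam j.
  by apply: char2_eq; rewrite -[RHS](balanced v); congr (_ + _);
     apply: eq_bigl => j; rewrite inE.
(* To the left of [v] the higher segment has the smaller slope, hence the sign. *)
have inj : {in [set i | b i == v]%SET &, injective (fun i => - slope i)}.
  by move=> i j iv jv /oppr_inj /(slope_inj_right iv jv).
rewrite -(telescope_flips lam _ _ inj).
rewrite [RHS](eq_bigl (fun i => i \in [set i | b i == v]%SET)); last by move=> i;
  rewrite inE.
apply: eq_bigr => i; rewrite inE => /eqP e;
  rewrite /bounds upperE (upper_right_at e).
suff -> : \sum_(j in [set j | b j == v]%SET | - slope i < - slope j) lam j =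
  \sum_(j in [set j | b j == v]%SET | slope j < slope i) lam j by [].
by apply: eq_bigl => j; rewrite ltrN2.
Qed.

End Arrangement.

(** * Segments with ends in arbitrary order *)

Lemma big_swap_ends (T : Type) (idx : T) (op : Monoid.com_law idx)
    (I : finType) (N : eqType) (p q : I -> N) (sw : pred I) (f : I -> T) (v : N) :
  op (\big[op/idx]_(i | (if sw i then p i else q i) == v) f i)
     (\big[op/idx]_(i | (if sw i then q i else p i) == v) f i) =
  op (\big[op/idx]_(i | p i == v) f i) (\big[op/idx]_(i | q i == v) f i).
Proof.
rewrite !(big_mkcond (fun i => _ == v)) -!big_split /=.
by apply: eq_bigr => i _; case: (sw i) => //; rewrite Monoid.mulmC.
Qed.

Section Unoriented.

Variables (R : realFieldType) (N I : finType) (px py : N -> R) (p q : I -> N).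
Hypothesis px_inj : injective px.
Hypothesis neq_pq : forall i, p i != q i.

Definition on_segment i x y := exists t : R,
  [/\ 0 <= t <= 1, x = (1 - t) * px (p i) + t * px (q i)
    & y = (1 - t) * py (p i) + t * py (q i)].

Hypothesis noncrossing : forall i j x y, i != j ->
  on_segment i x y -> on_segment j x y -> x = px (p j) \/ x = px (q j).

Variables (V : zmodType) (lam : I -> V).
Hypothesis char2 : forall v : V, v + v = 0.
Hypothesis balanced : forall v,
  \sum_(i | p i == v) lam i + \sum_(i | q i == v) lam i = 0.

(** Each segment is redirected from left to right. Sums over both kinds of ends do not notice the
    exchange, so the balance passes to the directed segments and the parity comes back. *)
Lemma arrangement_bounds : exists U : I -> V, forall (c : V) v,
  (\big[addb/false]_(i | p i == v) ((U i == c) (+) (U i + lam i == c)))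
  (+) (\big[addb/false]_(i | q i == v) ((U i == c) (+) (U i + lam i == c))) = false.
Proof.
pose sw i := px (p i) < px (q i).
pose a i := if sw i then p i else q i.
pose b i := if sw i then q i else p i.
have lt_ab i : px (a i) < px (b i).
  rewrite /a /b; case h: (sw i) => //.
  rewrite lt_neqAle leNgt -/(sw i) h andbT; apply: contraNneq (neq_pq i).
  by move/px_inj => ->.
have onP i x : px (a i) <= x <= px (b i) -> on_segment i x (height px py a b i x).
  move=> /andP[h1 h2]; have := lt_ab i; rewrite -subr_gt0 => d0.
  pose t := (x - px (a i)) / (px (b i) - px (a i)).
  have t01 : 0 <= t <= 1.
    rewrite /t ler_pdivrMr // mul1r lerD2r h2 andbT divr_ge0 ?subr_ge0 //.
    exact: ltW.
  have ex : x = (1 - t) * px (a i) + t * px (b i).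
    by rewrite /t; field; exact: lt0r_neq0.
  have ey : height px py a b i x = (1 - t) * py (a i) + t * py (b i).
    by rewrite /height /slope /t; field; exact: lt0r_neq0.
  move: ex ey; rewrite /on_segment; set y := height _ _ _ _ _ _.
  rewrite /a /b; case: (sw i) => ex ey; first by exists t.
  exists (1 - t); split; first by apply/andP; split; lra.
    by rewrite [LHS]ex; ring.
  by rewrite [LHS]ey; ring.
have nc i j x : i != j -> px (a i) <= x <= px (b i) ->
    px (a j) <= x <= px (b j) -> height px py a b i x = height px py a b j x ->
    x = px (a j) \/ x = px (b j).
  move=> ij /onP xi /onP xj e; rewrite -e in xj.
  have := noncrossing ij xi xj; rewrite /a /b.
  by case: (sw j) => -[]; [left|right|right|left].
exists (upper px py a b lam) => c v.
rewrite -(@big_swap_ends _ _ addb _ _ p q sw).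
have xor0 (x y : bool) : x = y -> x (+) y = false by move->; rewrite addbb.
apply: xor0.
apply: (bounds_even px_inj lt_ab nc char2) => u.
by rewrite (@big_swap_ends _ _ +%R _ _ p q sw) /= balanced.
Qed.

End Unoriented.

(** * A shear that makes abscissas distinct *)

Lemma fresh_scalar (R : realFieldType) (s : seq R) : exists e, e \notin s.
Proof.
have bound e : e \in s -> `|e| <= \sum_(x <- s) `|x|.
  by move=> h; rewrite (big_rem _ h) /= lerDl; apply: sumr_ge0.
exists (1 + \sum_(x <- s) `|x|); apply/negP => /bound.
have s0 : 0 <= \sum_(x <- s) `|x| by apply: sumr_ge0.
by rewrite ger0_norm ?gerDr ?ler10 // addr_ge0.
Qed.

Lemma rV2_eq (R : realFieldType) (u v : 'rV[R]_2) :
  u ord0 0 = v ord0 0 -> u ord0 1 = v ord0 1 -> u = v.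
Proof.
move=> h0 h1; apply/rowP => i.
have [->|->] : i = 0 \/ i = 1.
- by case: i => [[|[|//]] hi]; [left|right]; apply: val_inj.
- exact: h0.
- exact: h1.
Qed.

(** Two points with different ordinates receive the same sheared abscissa for a single [e], the
    quotient listed in [bad]. Distinct points with equal ordinates are never merged; their quotient
    by zero merely adds 0 to the list. *)
Lemma shear_injective (R : realFieldType) (s : seq 'rV[R]_2) :
  exists e : R, {in s &, injective (fun p : 'rV[R]_2 => p ord0 0 + e * p ord0 1)}.
Proof.
pose bad := [seq (p.2 ord0 0 - p.1 ord0 0) / (p.1 ord0 1 - p.2 ord0 1) |
             p : 'rV[R]_2 * 'rV[R]_2 <- [seq (u, v) | u <- s, v <- s]].
have [e ne] := fresh_scalar bad; exists e => u v us vs h.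
have h1 : u ord0 1 = v ord0 1.
  apply/eqP/negPn/negP => uv; move/negP: ne; apply.
  apply/mapP; exists (u, v); first exact: allpairs_f.
  rewrite /=; apply: (canRL (mulfK _)); first by rewrite subr_eq0.
  by apply/eqP; rewrite -subr_eq0; apply/eqP; lra.
have h0 : u ord0 0 = v ord0 0 by move: h; rewrite h1 => /addIr.
exact: rV2_eq.
Qed.

(** * Polygonal drawings *)

Section Polyline.

Variable R : realType.
Implicit Types (p q x : 'rV[R]_2) (s : seq 'rV[R]_2).

Definition pt p s k := nth p (p :: s) k.

Lemma segment_left p q : segment p q p.
Proof. by exists 0; rewrite ?lexx ?ler01 // subr0 scale1r scale0r addr0. Qed.

Lemma segment_right p q : segment p q q.
Proof. by exists 1; rewrite ?lexx ?ler01 // subrr scale1r scale0r add0r. Qed.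

Lemma ptS p q s k : (k <= size s)%N -> pt p (q :: s) k.+1 = pt q s k.
Proof. by move=> h; rewrite /pt /= (set_nth_default q). Qed.

Lemma polyline_segment p s k x : (k < size s)%N ->
  segment (pt p s k) (pt p s k.+1) x -> polyline p s x.
Proof.
elim: s p k => [|q s IH] p [|k] //= hk; first by left.
by rewrite !ptS // 1?ltnW // => h; right; apply: IH h.
Qed.

Lemma pt_polyline p s k : (k <= size s)%N -> polyline p s (pt p s k).
Proof.
elim: s p k => [|q s IH] p [|k] //= hk; first by left; apply: segment_left.
by rewrite ptS //; right; apply: IH.
Qed.

Lemma simple_polyline_uniq p s : simple_polyline p s -> uniq (p :: s).
Proof.
elim: s p => [|q s IH] p // [pq h /IH uqs]; rewrite cons_uniq uqs andbT.
apply/negP => pqs; move/eqP: pq; apply; apply: h; split; first exact: segment_left.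
have -> : p = pt q s (index p (q :: s)) by rewrite /pt nth_index.
by apply: pt_polyline; rewrite -ltnS -[(size s).+1]/(size (q :: s)) index_mem.
Qed.

Lemma pt_inj p s k l : simple_polyline p s -> (k <= size s)%N -> (l <= size s)%N ->
  pt p s k = pt p s l -> k = l.
Proof.
by move=> /simple_polyline_uniq u hk hl /eqP; rewrite nth_uniq // => /eqP.
Qed.

(** The first segment meets the rest only at its end [q]. If [q] also lay on a segment after the
    next one, it would be a meeting point of the next segment with its tail, other than the allowed
    one. *)
Lemma simple_polyline_meet p s i j x : simple_polyline p s ->
  (i < j < size s)%N -> segment (pt p s i) (pt p s i.+1) x ->
  segment (pt p s j) (pt p s j.+1) x -> j = i.+1 /\ x = pt p s j.
Proof.
elim: s p i j => [|q s IH] p i [|j]; rewrite ?andbF //=; case: i => [|i].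
  case=> pq h sq /=; rewrite ltnS => hj xi.
  rewrite !ptS // 1?ltnW // => xj.
  have xq : x = q by apply: h; split; [exact: xi | exact: (polyline_segment hj xj)].
  case: j hj xj => [|j] hj xj; first by [].
  case: s sq hj xj {h IH xi} => [|q' s] //= [qq' h' _] hj.
  rewrite !ptS // 1?ltnW // xq => xj.
  by move/eqP: qq'; case; apply: h'; split;
    [exact: segment_left | exact: (polyline_segment hj xj)].
case=> _ _ sq; rewrite !ltnS => /andP[ij hj].
have hi := ltn_trans ij hj.
rewrite !ptS // 1?ltnW // => xi xj.
have ij' : (i < j < size s)%N by rewrite ij.
by have [-> ->] := IH _ _ _ sq ij' xi xj.
Qed.

Lemma pt_on_segment p s k m : simple_polyline p s -> (k < size s)%N ->
  (m <= size s)%N -> segment (pt p s k) (pt p s k.+1) (pt p s m) ->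
  m = k \/ m = k.+1.
Proof.
move=> sp hk hm h; case: (ltngtP m k) => mk; last by left.
  have mks : (m < k < size s)%N by rewrite mk.
  have [e1 e2] := simple_polyline_meet sp mks (segment_left _ _) h.
  by have := pt_inj sp hm (ltnW hk) e2; left.
right; case: (ltngtP m k.+1) => // mk'; first by move: mk'; rewrite ltnS leqNgt mk.
case: m hm h mk mk' => // m hm h _ mk'.
have kms : (k < m < size s)%N by rewrite hm andbT -ltnS.
have [e1 e2] := simple_polyline_meet sp kms h (segment_right _ _).
by have /eqP := pt_inj sp hm (ltnW hm) e2; rewrite eqn_leq ltnn.
Qed.

End Polyline.

(** Along a polygonal arc every bend occurs as the end of one segment and the start of the next, and
    cancels; only the two ends of the arc survive. *)
Lemma big_telescope (T : Type) (idx : T) (op : Monoid.com_law idx)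
    (opxx : forall x, op x x = idx) (f : nat -> T) n :
  \big[op/idx]_(k < n) op (f k) (f k.+1) = op (f 0) (f n).
Proof.
elim: n => [|n IH]; first by rewrite big_ord0 opxx.
rewrite big_ord_recr /= IH Monoid.mulmA; congr (op _ _).
by rewrite -Monoid.mulmA /= opxx Monoid.mulm1.
Qed.

(** * From the segments of a drawing to its edges *)

Section Drawing.

Variables (R : realType) (G : sgraph) (F : {set {set G}}).
Variables (pos : G -> 'rV[R]_2) (curve : {set G} -> set 'rV[R]_2).
Hypothesis drawing : plane_drawing pos curve.
Hypothesis sub_edges : F \subset edges G.

(** The polyline comes with a choice of first endpoint, since an edge has no direction. A set
    outside [F] gets an empty list and so contributes no segment. *)
Definition drawn_as E (ps : 'rV[R]_2 * seq 'rV[R]_2) :=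
  if E \in F then exists u v : G,
    [/\ E = [set u; v]%SET /\ u != v, ps.1 = pos u, last ps.1 ps.2 = pos v,
        simple_polyline ps.1 ps.2 & curve E = polyline ps.1 ps.2]
  else ps.2 = [::].

Lemma drawn_as_ex E : exists ps, drawn_as E ps.
Proof.
rewrite /drawn_as; case EF: (E \in F); last by exists (0, [::]).
have := fintype.subsetP sub_edges _ EF.
rewrite inE => /existsP[u /existsP[v /andP[uv /eqP eE]]].
case: drawing => _ arcs _ _; have [s [h1 h2 h3]] := arcs _ _ uv.
exists (pos u, s), u, v; rewrite eE; split => //; split => //.
by apply: contraTneq uv => ->; rewrite adj_irrefl.
Qed.

Variables (P0 : {set G} -> 'rV[R]_2) (S : {set G} -> seq 'rV[R]_2).
Hypothesis drawn : forall E, drawn_as E (P0 E, S E).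

Let n E := size (S E).
Let dot E k := pt (P0 E) (S E) k.

Definition arc_segment : finType := {E : {set G} & 'I_(size (S E))}.

Definition arc_seg E (k : 'I_(size (S E))) : arc_segment :=
  Tagged (fun E => 'I_(size (S E))) k.

Lemma arc_in (i : arc_segment) : tag i \in F.
Proof.
case: i => E [k hk] /=; have := drawn E; rewrite /drawn_as /=.
by case: (E \in F) => // e; rewrite e in hk.
Qed.

Lemma arc_simple E : E \in F -> simple_polyline (P0 E) (S E).
Proof. by move=> EF; have := drawn E; rewrite /drawn_as EF => -[u [v []]]. Qed.

Lemma arc_curve E : E \in F -> curve E = polyline (P0 E) (S E).
Proof. by move=> EF; have := drawn E; rewrite /drawn_as EF => -[u [v []]]. Qed.

Lemma arc_vertex E w : E \in F -> w \in E -> pos w = dot E 0 \/ pos w = dot E (n E).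
Proof.
move=> EF wE; have := drawn E; rewrite /drawn_as EF =>
  -[u [v [[eE _]]]] /= h1 h2 _ _.
rewrite eE !inE in wE; case/orP: wE => /eqP ->; [left|right].
  by rewrite -h1.
by rewrite -h2 /dot /pt /n (last_nth (P0 E)).
Qed.

Lemma arc_meet E E' x : E \in F -> E' \in F -> E != E' ->
  polyline (P0 E) (S E) x -> polyline (P0 E') (S E') x ->
  exists w, [/\ w \in E, w \in E' & x = pos w].
Proof.
move=> EF E'F ne; rewrite -!arc_curve // => h h'.
case: drawing => _ _ _ meet.
have [w] := meet _ _ _ (fintype.subsetP sub_edges _ EF) (fintype.subsetP
  sub_edges _ E'F) ne h h'.
by rewrite inE => /andP[? ?] ?; exists w.
Qed.

Definition seg_set (i : arc_segment) :=
  segment (dot (tag i) (tagged i)) (dot (tag i) (tagged i).+1).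

(** Within one arc this is [simple_polyline_meet]. Different arcs meet only at a common vertex; it
    is an end of the arc of [j], hence a corner, and a corner lies on a segment of its arc only as
    an end of that segment. *)
Lemma seg_meet i j x : i != j -> seg_set i x -> seg_set j x ->
  x = dot (tag j) (tagged j) \/ x = dot (tag j) (tagged j).+1.
Proof.
have := arc_in j; have := arc_in i; rewrite /seg_set.
case: i j => [E k] [E' k'] /= EF E'F ij xk xk'.
have [e|ne] := eqVneq E E'.
  case: _ / e in k' E'F ij xk' *.
  have kk : (k : nat) != k' by apply: contraNneq ij => /val_inj ->.
  case: (ltngtP k k') kk => // kk _.
    have kk' : (k < k' < size (S E))%N by rewrite kk ltn_ord.
    by left; have [] := simple_polyline_meet (arc_simple EF) kk' xk xk'.
  have kk' : (k' < k < size (S E))%N by rewrite kk ltn_ord.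
  by right; have [e ->] := simple_polyline_meet (arc_simple EF) kk' xk' xk;
    rewrite e.
have [w [wE wE' xw]] := arc_meet EF E'F ne (polyline_segment (ltn_ord k) xk)
  (polyline_segment (ltn_ord k') xk').
rewrite xw in xk' *.
have on m : (m <= n E')%N -> pos w = dot E' m ->
    pos w = dot E' k' \/ pos w = dot E' k'.+1.
  move=> hm e; rewrite e in xk' *.
  by have [->|->] := pt_on_segment (arc_simple E'F) (ltn_ord k') hm xk';
    [left|right].
by have [/on|/on] := arc_vertex E'F wE'; apply.
Qed.

(** A point on two arcs is a vertex, and vertices occur on an arc only at its ends. Hence exactly
    two segments meet at a bend. *)
Lemma bend_unique E k E' k' : E \in F -> E' \in F -> (k.+1 < n E)%N ->
  (k' <= n E')%N ->
  dot E' k' = dot E k.+1 -> E' = E /\ k' = k.+1.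
Proof.
move=> EF E'F hk hk' e.
have [eE|ne] := eqVneq E' E.
  rewrite eE in hk' e *; split=> //.
  exact: (pt_inj (arc_simple EF) hk' (ltnW hk) e).
have h' : polyline (P0 E') (S E') (dot E k.+1) by rewrite -e; apply: pt_polyline.
have [w [_ wE xw]] := arc_meet E'F EF ne h' (pt_polyline _ (ltnW hk)).
have [] := arc_vertex EF wE; rewrite -xw => /(pt_inj (arc_simple EF) (ltnW hk)) e'.
  by have := e' (leq0n _).
by move: hk; rewrite -e' ?ltnn.
Qed.

Lemma big_arcs (T : Type) (idx : T) (op : Monoid.com_law idx)
    (opxx : forall x, op x x = idx) (g : {set G} -> T) w :
  op (\big[op/idx]_(i : arc_segment | dot (tag i) (tagged i) == pos w) g (tag i))
     (\big[op/idx]_(i : arc_segment | dot (tag i) (tagged i).+1 == pos w) g (tag i))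
  = \big[op/idx]_(E in F | w \in E) g E.
Proof.
rewrite !(big_mkcond (fun i => _ == _)) -big_split /=.
rewrite -(@sig_big_dep _ _ _ {set G} (fun E => 'I_(size (S E))) predT (fun _ =>
  predT)
  (fun E k => op (if dot E k == pos w then g E else idx)
                 (if dot E k.+1 == pos w then g E else idx))) /=.
rewrite [RHS]big_mkcond /=; apply: eq_bigr => E _.
rewrite (big_telescope opxx (fun k => if dot E k == pos w then g E else idx)).
have := drawn E; rewrite /drawn_as; case: (E \in F) => /= [|->];
  last by rewrite opxx.
move=> [u [v [[eE uv] h1 h2 _ _]]].
have -> : dot E (size (S E)) = pos v by rewrite -h2 /dot /pt (last_nth (P0 E)).
have -> : dot E 0 = pos u by rewrite -h1.
case: drawing => inj _ _ _; rewrite !(inj_eq inj) eE !inE ![w == _]eq_sym.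
case: (u =P w) uv => [->|_] uv; case: (v =P w) => [e|_] /=;
  rewrite ?Monoid.mulm1 ?Monoid.mul1m //.
by rewrite e eqxx in uv.
Qed.

Lemma big_arcs_off (T : Type) (idx : T) (op : Monoid.com_law idx)
    (opxx : forall x, op x x = idx) (g : {set G} -> T) x : (forall w, x <> pos w) ->
  op (\big[op/idx]_(i : arc_segment | dot (tag i) (tagged i) == x) g (tag i))
     (\big[op/idx]_(i : arc_segment | dot (tag i) (tagged i).+1 == x) g (tag i))
  = idx.
Proof.
move=> off; rewrite !(big_mkcond (fun i => _ == _)) -big_split /=.
rewrite -(@sig_big_dep _ _ _ {set G} (fun E => 'I_(size (S E))) predT (fun _ =>
  predT)
  (fun E k => op (if dot E k == x then g E else idx)
                 (if dot E k.+1 == x then g E else idx))) /=.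
rewrite big1 // => E _.
rewrite (big_telescope opxx (fun k => if dot E k == x then g E else idx)).
have := drawn E; rewrite /drawn_as; case: (E \in F) => /= [|->];
  last by rewrite opxx.
move=> [u [v [_ h1 h2 _ _]]].
have -> : dot E (size (S E)) = pos v by rewrite -h2 /dot /pt (last_nth (P0 E)).
have -> : dot E 0 = pos u by rewrite -h1.
by do 2![case: eqP => [/esym /off //|_]]; rewrite Monoid.mulm1.
Qed.

Variables (V : zmodType) (lam : {set G} -> V).
Hypothesis char2 : forall v : V, v + v = 0.
Hypothesis balanced : forall w : G, \sum_(E in F | w \in E) lam E = 0.

(** After a shear, [arrangement_bounds] applies to all segments of all arcs. Its parity statement at
    the bends makes the answer for [c] constant along each arc, and at the vertices it becomes the
    claim. *)
Lemma drawing_bounds : exists U : {set G} -> V, forall (c : V) (w : G),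
  \big[addb/false]_(E in F | w \in E) ((U E == c) (+) (U E + lam E == c)) = false.
Proof.
pose dots := flatten [seq P0 E :: S E | E : {set G}].
have dotP E k : (k <= n E)%N -> dot E k \in dots.
  move=> hk; apply/flatten_mapP; exists E; first by rewrite mem_enum.
  by apply: mem_nth.
have [e inj] := shear_injective dots.
pose N := seq_sub dots.
pose px (v : N) := ssval v ord0 0 + e * ssval v ord0 1.
pose py (v : N) := ssval v ord0 1.
pose p (i : arc_segment) : N := SeqSub (dotP (tag i) (tagged i) (ltnW (ltn_ord
  (tagged i)))).
pose q (i : arc_segment) : N := SeqSub (dotP (tag i) (tagged i).+1 (ltn_ord
  (tagged i))).
have px_inj : injective px by move=> u v /inj h; apply/val_inj/h; apply: ssvalP.
have neq_pq i : p i != q i.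
  apply/eqP => /(congr1 val) /= /(pt_inj (arc_simple (arc_in i)) (ltnW (ltn_ord
    _)) (ltn_ord _)).
  by move/eqP; rewrite eqn_leq ltnn andbF.
have onP i x y : on_segment px py p q i x y -> exists z : 'rV[R]_2,
    [/\ seg_set i z, x = z ord0 0 + e * z ord0 1 & y = z ord0 1].
  case=> t [t01 ex ey]; exists ((1 - t) *: dot (tag i) (tagged i) + t *: dot (tag
    i) (tagged i).+1).
  by split; [exists t | rewrite ex /px /= !mxE; ring | rewrite ey /py /= !mxE].
have nc i j x y : i != j -> on_segment px py p q i x y ->
  on_segment px py p q j x y ->
    x = px (p j) \/ x = px (q j).
  move=> ij /onP[z [zi xz yz]] /onP[z' [zj xz' yz']].
  have zz : z = z'.
    have e1 : z ord0 1 = z' ord0 1 by rewrite -yz -yz'.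
    by apply: rV2_eq => //; move: xz xz'; rewrite e1 => -> /addIr.
  rewrite -zz in zj.
  by rewrite xz /px /=; case: (seg_meet ij zi zj) => ->; [left|right].
(* At a vertex this is the balance of the edge labels; at a bend the label of the arc occurs
   twice. *)
have bal v : \sum_(i | p i == v) lam (tag i) + \sum_(i | q i == v) lam (tag i) = 0.
  have [[w ew]|off] := pselect (exists w, ssval v = pos w).
    by rewrite -[RHS](balanced w) -(big_arcs (op := +%R) char2) /= -ew;
      congr (_ + _).
  rewrite -[RHS](@big_arcs_off _ 0 +%R char2 lam (ssval v)) // => w ew.
  by apply: off; exists w.
have [Us evenU] := arrangement_bounds px_inj neq_pq nc char2 bal.
pose bd c i := (Us i == c) (+) (Us i + lam (tag i) == c).
(* Parity at the bend forces its two segments to agree. Where the arc turns back, upper and lower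
   side change roles, so the test for [c] is carried along and not the value [Us]. *)
have bd_step c E (k k' : 'I_(size (S E))) : k' = k.+1 :> nat ->
    bd c (arc_seg k) = bd c (arc_seg k').
  move=> kk'; set i := arc_seg k; set i' := arc_seg k'.
  have EF : E \in F := arc_in i.
  have hk : (k.+1 < n E)%N by rewrite -kk'.
  have := evenU c (q i).
  rewrite (big_pred1 i'); last first.
    move=> x; apply/eqP/eqP => [/(congr1 val) /=|->]; last by apply: val_inj;
      rewrite /= kk'.
    case: x => E' l /(bend_unique EF (arc_in (arc_seg l)) hk (ltnW (ltn_ord
      l)))[/= /esym eE].
    by case: _ / eE in l * => ll; congr existT; apply: val_inj; rewrite /= ll kk'.
  rewrite (big_pred1 i); last first.
    move=> x; apply/eqP/eqP => [/(congr1 val) /=|-> //].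
    case: x => E' l /(bend_unique EF (arc_in (arc_seg l)) hk (ltn_ord l))[/=
      /esym eE].
    by case: _ / eE in l * => -[ll]; congr existT; apply: val_inj.
  by rewrite -!/(bd c _); case: (bd c i); case: (bd c i').
(* The first segment represents the whole arc; the default 0 is for sets without segments. *)
pose U E : V := if (insub 0%N : option 'I_(size (S E))) is Some k then Us
  (arc_seg k) else 0.
have bd0 c (i : arc_segment) : bd c i =
  ((U (tag i) == c) (+) (U (tag i) + lam (tag i) == c)).
  case: i => E [k hk] /=; elim: k hk => [|k IH] hk; last first.
    by rewrite -(IH (ltnW hk)); symmetry; apply: bd_step.
  by rewrite /U insubT.
exists U => c w.
rewrite -(@big_arcs _ false addb addbb (fun E =>
  (U E == c) (+) (U E + lam E == c)) w) /=.
have [wd|wd] := boolP (pos w \in dots).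
  rewrite -[RHS](evenU c (SeqSub wd)).
  by congr (_ (+) _); apply: eq_big => // i _; rewrite -bd0.
have notd E k : (k <= n E)%N -> (dot E k == pos w) = false.
  by move=> /dotP h; apply: contraNF wd => /eqP <-.
by rewrite !big_pred0 // => i; rewrite notd // ?ltn_ord // ltnW ?ltn_ord.
Qed.

End Drawing.

(** * Even covers of planar graphs *)

Definition edges_in (G : sgraph) (W : {set G}) : {set {set G}} :=
  [set E in edges G | E \subset W]%SET.

Lemma edge_pair (G : sgraph) (E : {set G}) : E \in edges G ->
  exists u v, [/\ adj u v, u != v & E = [set u; v]%SET].
Proof.
rewrite inE => /existsP[u /existsP[v /andP[uv /eqP eE]]].
by exists u, v; split=> //; apply: contraTneq uv => ->; rewrite adj_irrefl.
Qed.

Lemma card_edge (G : sgraph) (E : {set G}) : E \in edges G -> #|E| = 2%N.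
Proof. by case/edge_pair=> u [v [_ uv ->]]; rewrite cards2 uv. Qed.

Lemma F2_addxx (x : 'F_2) : x + x = 0.
Proof. by case: x => [[|[|//]] h]; apply: val_inj. Qed.

Lemma odd_card_big (T : finType) (P : pred T) :
  odd #|[set x | P x]%SET| = \big[addb/false]_x P x.
Proof.
rewrite -sum1_card big_mkcond /= (big_morph odd oddD (erefl _)).
by apply: eq_bigr => x _; rewrite inE; case: (P x).
Qed.

(** A substitute for the bounded faces in Euler's formula: [A] consists of the nonzero values
    occurring beside an edge, and [D E] of the values on exactly one side of [E]. *)
Lemma planar_cycle_cover (R : realType) (G : sgraph) (W : {set G}) :
  planar R G -> W != finset.set0 ->
  exists (T : finType) (A : {set T}) (D : {set G} -> {set T}),
  [/\ (#|edges_in W| < #|A| + #|W|)%N, forall E, (#|D E| <= 2)%N,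
      forall c, c \in A -> exists2 E, E \in edges_in W & c \in D E
    & forall w c, ~~ odd #|[set E in edges_in W | (w \in E) && (c \in D E)]%SET|].
Proof.
move=> [pos [curve drawing]] W0.
set F := edges_in W; have FE E : E \in F -> E \in edges G by rewrite inE => /andP[].
have FW E : E \in F -> E \subset W by rewrite inE => /andP[].
pose Inc : 'M['F_2]_(#|F|, #|W|) := \matrix_(e, v)
  (((enum_val v : G) \in (enum_val e : {set G}))%:R).
(* The rows of [K] span the cycle space over F_2. The label of an edge is its column of [K], so
   [K *m Inc = 0] expresses that the labels at each vertex of [W] cancel. *)
have [K [KI rankKer]] : exists K : 'M['F_2]_#|F|,
    K *m Inc = 0 /\ \rank K = (#|F| - \rank Inc)%N.
  by exists (kermx Inc); rewrite mulmx_ker mxrank_ker.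
pose lam E : 'rV['F_2]_#|F| := \row_j \sum_(e | enum_val e == E) K j e.
have lamE e : lam (enum_val e) = row e K^T.
  apply/rowP => j; rewrite !mxE (big_pred1 e) // => e'.
  by rewrite (inj_eq enum_val_inj).
have char2 (v : 'rV['F_2]_#|F|) : v + v = 0.
  by apply/rowP => j; rewrite !mxE F2_addxx.
have balanced (w : G) : \sum_(E in F | w \in E) lam E = 0.
  have [wW|wW] := boolP (w \in W); last first.
    rewrite big_pred0 // => E; apply/negP => /andP[/FW /fintype.subsetP h /h].
    by rewrite (negbTE wW).
  rewrite big_mkcondr big_enum_val /=; apply/rowP => j.
  move/matrixP/(_ j (enum_rank_in wW w)): KI.
  rewrite !mxE => <-; rewrite summxE; apply: eq_bigr => e _.
  rewrite !mxE enum_rankK_in // lamE.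
  by case: (w \in _); rewrite !mxE ?mulr1 ?mulr0.
(* Every edge has two ends, so the all-one vector is in the kernel; this gives the extra 1 over E -
   V. *)
have rankInc : (\rank Inc < #|W|)%N.
  pose one : 'cV['F_2]_#|W| := const_mx 1.
  have e0 : Inc *m one = 0.
    apply/matrixP => e j; rewrite !mxE.
    have EF : enum_val e \in F := enum_valP e.
    under eq_bigr => v _ do rewrite !mxE mulr1.
    rewrite -natr_sum -(big_enum_val (fun v : G =>
      nat_of_bool (v \in (enum_val e : {set G})))) /=.
    rewrite (eq_bigr (fun v => if v \in (enum_val e : {set G}) then 1 else 0)%N);
      last first.
      by move=> v _; case: (v \in _).
    rewrite -big_mkcondr (eq_bigl (fun v => v \in (enum_val e : {set G})));
      last first.
      move=> v; rewrite andbC; case h: (v \in _) => //=.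
      exact: (fintype.subsetP (FW _ EF)).
    rewrite sum1_card.
    by rewrite (card_edge (FE _ EF)); apply: F2_addxx.
  have := mulmx0_rank_max e0.
  suff : (0 < \rank one)%N by move=> h h'; apply: leq_trans h';
    rewrite -addn1 leq_add2l.
  rewrite lt0n mxrank_eq0; apply/eqP => /matrixP h.
  case/set0Pn: W0 => w wW; have := h (enum_rank_in wW w) ord0.
  by rewrite !mxE => /eqP; rewrite oner_eq0.
have subF : F \subset edges G by apply/fintype.subsetP.
have [PS drawn] := choice (drawn_as_ex drawing subF).
have drawn' E : drawn_as F pos curve E (fst (PS E), snd (PS E)).
  by have := drawn E; case: (PS E).
have [U evenU] := drawing_bounds drawing subF drawn' char2 balanced.
pose D E := [set c | (U E == c) (+) (U E + lam E == c)]%SET.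
pose A := [set c : 'rV['F_2]_#|F| | (c != 0) && [exists E in F, c \in D E]]%SET.
exists ('rV['F_2]_#|F| : finType), A, D; split.
(* A nonzero label is the sum of the two distinct values beside its edge, so [A] spans all labels
   and has at least as many elements as their rank. *)
- have rankK : (\rank K^T <= #|A|)%N.
    pose X : 'M['F_2]_(#|A|, #|F|) := \matrix_i enum_val i.
    have XP c E : E \in F -> c \in D E -> (c <= X)%MS.
      move=> EF cE; have [->|c0] := eqVneq c 0; first exact: sub0mx.
      have cA : c \in A by rewrite inE c0; apply/existsP; exists E; rewrite EF.
      have -> : c = row (enum_rank_in cA c) X by rewrite rowK enum_rankK_in.
      exact: row_sub.
    apply: leq_trans (rank_leq_row X); apply: mxrankS; apply/row_subP => e.
    rewrite -lamE; have EF : enum_val e \in F := enum_valP e.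
    move: (enum_val e) EF => E EF.
    have [->|l0] := eqVneq (lam E) 0; first exact: sub0mx.
    have ne : U E + lam E != U E by rewrite -subr_eq0 addrAC subrr add0r.
    have -> : lam E = U E + (U E + lam E) by rewrite addrA char2 add0r.
    by apply: addmx_sub; apply: (XP _ E) => //;
      rewrite inE eqxx ?(negbTE ne) // eq_sym (negbTE ne).
  have := rankK; rewrite mxrank_tr rankKer leq_subLR => h.
  by apply: leq_ltn_trans h _; rewrite addnC ltn_add2l.
- move=> E; apply: (@leq_trans #|[set U E; U E + lam E]%SET|).
    apply: subset_leq_card; apply/fintype.subsetP => c;
      rewrite !inE ![c == _]eq_sym.
    by do 2![case: eqP].
  by rewrite cards2; case: eqP.
- by move=> c; rewrite inE => /andP[_ /existsP[E /andP[EF cE]]]; exists E.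
- move=> w c; apply/negPf; rewrite odd_card_big.
  rewrite -[RHS](evenU c w) [RHS]big_mkcond /=; apply: eq_bigr => E _.
  by rewrite [c \in _]inE; case: (E \in F); case: (w \in E).
Qed.

Local Close Scope ring_scope.

(** * Discharging *)

(** Without leaves a path can always be prolonged at its head by an edge other than its first one.
    If no repeated vertex ever closed a cycle, paths would outgrow [T]. *)
Lemma cycle_ex (T : finType) (e : rel T) (x y : T) :
  symmetric e -> irreflexive e ->
  (forall u v, e u v -> exists2 z, z != v & e u z) ->
  e x y -> exists2 s, 2 < size s & ucycleb e s.
Proof.
move=> e_sym e_irr no_leaf exy; apply: contrapT => no_cycle.
have long n : exists x y p, [/\ path e x (y :: p), uniq (x :: y :: p) & size p = n].
  elim: n => [|n [{exy}x [{}y [p [xp up sp]]]]].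
    exists x, y, [::]; split; rewrite //= ?exy // inE !andbT.
    by apply: contraTneq exy => ->; rewrite e_irr.
  have exy : e x y by case/andP: xp.
  have [z zy exz] := no_leaf _ _ exy.
  have [zp|zp] := boolP (z \in x :: y :: p); last first.
    exists z, x, (y :: p); rewrite cons_uniq zp up; split=> //=; last by rewrite sp.
    by rewrite e_sym exz.
  (* The repeated vertex is neither the head nor its successor, so the cycle has at least three
     vertices. *)
  have {}zp : z \in p.
    move: zp; rewrite !inE (negbTE zy) /=; case: eqP => // zx.
    by rewrite zx e_irr in exz.
  case: no_cycle; case/splitPr: zp xp up {sp} => p1 p2 xp up.
  exists (x :: y :: rcons p1 z); first by rewrite /= size_rcons.
  move: xp up; rewrite -cat_rcons -2!cat_cons cat_uniq /= cat_path =>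
    /and3P[h1 h2 _].
  case/and3P=> /and3P[u1 u2 u3] _ _.
  by rewrite /ucycleb /= h1 u1 u2 u3 rcons_path h2 last_rcons e_sym exz.
have [u [v [p [_ up sp]]]] := long #|T|.
by have := uniq_leq_size up (fun z _ => mem_enum T z);
  rewrite /= -cardE sp ltnNge leqnSn.
Qed.

(** * Degrees and weights in an induced subgraph *)

Section Degrees.

Variable (G : sgraph) (W : {set G}).

Definition nbrs v := [set u in W | adj v u]%SET.
Definition deg v := #|nbrs v|.

Lemma nbrs_sym u v : u \in W -> v \in W -> (u \in nbrs v) = (v \in nbrs u).
Proof. by move=> uW vW; rewrite !inE uW vW adj_sym. Qed.

Lemma adj_neq (u v : G) : adj u v -> u != v.
Proof. by apply: contraTneq => ->; rewrite adj_irrefl. Qed.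

Lemma mem_edges_in u v : ([set u; v]%SET \in edges_in W) =
  [&& adj u v, u \in W & v \in W].
Proof.
rewrite inE finset.subUset !finset.sub1set; congr (_ && _).
apply/idP/idP => [/edge_pair[x [y [xy _ /setP e]]]|uv]; last first.
  by rewrite inE; apply/existsP; exists u; apply/existsP; exists v; rewrite uv eqxx.
have := e x; have := e y; rewrite !inE !eqxx orbT /=.
by do 2![case/orP=> /eqP ?]; subst; rewrite ?adj_irrefl // in xy *; rewrite adj_sym.
Qed.

Lemma edges_at v : v \in W ->
  [set E in edges_in W | v \in E]%SET = [set [set v; u] | u in nbrs v]%SET.
Proof.
move=> vW; apply/setP => E; rewrite inE; apply/andP/imsetP => [[EF vE]|[u]].
  have [x [y [_ _ eE]]] : exists x y, [/\ adj x y, x != y & E = [set x; y]%SET].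
    by apply: edge_pair; move: EF; rewrite inE => /andP[].
  move: EF vE; rewrite eE mem_edges_in => /and3P[xy xW yW]; rewrite !inE.
  by case/orP=> /eqP ->; [exists y|exists x];
    rewrite ?inE ?xW ?yW //= 1?adj_sym // finset.setUC.
rewrite inE => /andP[uW vu] ->; rewrite mem_edges_in vu vW uW.
by rewrite !inE eqxx.
Qed.

Lemma card_edges_at v : v \in W -> #|[set E in edges_in W | v \in E]%SET| = deg v.
Proof.
move=> vW; rewrite edges_at // card_in_imset // => x y.
rewrite !inE => /andP[_ /adj_neq vx] /andP[_ /adj_neq vy] /setP /(_ x).
by rewrite !inE eqxx orbT eq_sym (negbTE vx) => /esym /eqP.
Qed.

Lemma edge_sub E x : E \in edges_in W -> x \in E -> x \in W.
Proof. by rewrite inE => /andP[_ /fintype.subsetP h] /h. Qed.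

Lemma handshake : \sum_(v in W) deg v = 2 * #|edges_in W|.
Proof.
transitivity (\sum_(v in W) \sum_(E in edges_in W) (v \in E)).
  apply: eq_bigr => v vW; rewrite -card_edges_at // -sum1dep_card big_mkcondr.
  by apply: eq_bigr => E _; case: (v \in E).
rewrite exchange_big /= mulnC -sum_nat_const; apply: eq_bigr => E EF.
rewrite -(@card_edge _ E); last by move: EF; rewrite inE => /andP[].
rewrite -sum1_card [RHS]big_mkcond [LHS]big_mkcond /=; apply: eq_bigr => x _.
by case xE: (x \in E); [rewrite (edge_sub EF xE) | case: ifP].
Qed.

Definition reducible v : Prop :=
  [\/ deg v <= 1,
      deg v = 2 /\ exists2 x, x \in nbrs v & deg x <= 5
    | deg v = 3 /\ exists x y, [/\ x \in nbrs v, y \in nbrs v, x != y, deg x =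
      3 & deg y = 3]].

(** For d = 2, 3, 4, 6 this is 6 - 12/d, the largest value that [deg_wt] permits. Degrees 0 and 1
    are listed for totality; [deg_ge2] excludes them. *)
Definition wt v := match deg v with 0 | 1 | 2 => 0 | 3 => 2 | 4 | 5 => 3 | _ =>
  4 end.

Hypothesis irreducible : forall v, v \in W -> ~ reducible v.

Lemma deg_ge2 v : v \in W -> 2 <= deg v.
Proof. by move=> /irreducible h; rewrite ltnNge; apply/negP => h'; apply: h;
  constructor 1. Qed.

Lemma deg2_nbr u v : u \in W -> v \in W -> adj u v -> deg u = 2 -> 6 <= deg v.
Proof.
move=> uW vW uv du; rewrite ltnNge; apply/negP => dv; apply: (irreducible uW).
by constructor 2; split=> //; exists v; rewrite // inE vW.
Qed.

Lemma deg_wt v : v \in W -> wt v * deg v + 12 <= 6 * deg v.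
Proof. by move=> /deg_ge2; rewrite /wt;
  case: (deg v) => [|[|[|[|[|[|d]]]]]] // _; lia. Qed.

Lemma wt_eq0 v : v \in W -> (wt v == 0) = (deg v == 2).
Proof. by move=> /deg_ge2; rewrite /wt; case: (deg v) => [|[|[|[|[|[|d]]]]]]. Qed.

Lemma wt_big v : 6 <= deg v -> wt v = 4.
Proof. by rewrite /wt; case: (deg v) => [|[|[|[|[|[|d]]]]]]. Qed.

Lemma wt_small v : 0 < wt v < 3 -> deg v = 3 /\ wt v = 2.
Proof. by rewrite /wt; case: (deg v) => [|[|[|[|[|[|d]]]]]]. Qed.

Lemma wt_gt0 v : 0 < wt v -> 2 <= wt v.
Proof. by rewrite /wt; case: (deg v) => [|[|[|[|[|[|d]]]]]]. Qed.

Lemma wt_adj u v : u \in W -> v \in W -> adj u v -> 4 <= wt u + wt v.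
Proof.
move=> uW vW uv.
have [/eqP|u0] := posnP (wt u).
  by rewrite wt_eq0 // => /eqP /(deg2_nbr uW vW uv) /wt_big ->; rewrite leq_addl.
have [/eqP|v0] := posnP (wt v).
  by rewrite adj_sym in uv; rewrite wt_eq0 // =>
    /eqP /(deg2_nbr vW uW uv) /wt_big ->; rewrite leq_addr.
by have := wt_gt0 u0; have := wt_gt0 v0; lia.
Qed.

(** A positive weight is at least 2, so a total of at most 6 would make all three vertices
    3-vertices, and [y] would be reducible. *)
Lemma wt_path x y z : x \in W -> y \in W -> z \in W -> adj x y -> adj y z ->
  x != z ->
  0 < wt x -> 0 < wt y -> 0 < wt z -> 7 <= wt x + wt y + wt z.
Proof.
move=> xW yW zW xy yz xz x0 y0 z0.
have := wt_gt0 x0; have := wt_gt0 y0; have := wt_gt0 z0 => z2 y2 x2.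
rewrite leqNgt; apply/negP => lt7.
have [dx _] : deg x = 3 /\ wt x = 2 by apply: wt_small; lia.
have [dy _] : deg y = 3 /\ wt y = 2 by apply: wt_small; lia.
have [dz _] : deg z = 3 /\ wt z = 2 by apply: wt_small; lia.
apply: (irreducible yW); constructor 3; split=> //; exists x, z.
by rewrite !inE xW zW yz adj_sym xy.
Qed.

(** A 2-vertex on the cycle has two neighbours of weight 4, and length at least 5 leaves a further
    edge of weight at least 4. Otherwise all weights are at least 2, which settles length at least
    6. In a 5-cycle the five triples of consecutive vertices total at least 35 and count each vertex
    three times, so the weight is at least 12. *)
Lemma cycle_wt s : girth_at_least 5 G -> is_cycle s -> {subset s <= W} ->
  12 <= \sum_(x <- s) wt x.
Proof.
move=> girth cyc sW; have s5 := girth _ cyc.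
have /andP[_ ucyc] := cyc.
have [/hasP[v vs /eqP v0]|/hasPn pos] := boolP (has (fun v => wt v == 0) s).
  have [i s' es] := rot_to vs.
  have sz : size (v :: s') = size s by rewrite -es size_rot.
  have : ucycleb (@adj G) (v :: s') by rewrite -es /ucycleb rot_cycle rot_uniq.
  have {}sW x : x \in v :: s' -> x \in W by rewrite -es mem_rot => /sW.
  have -> : \sum_(x <- s) wt x = \sum_(x <- v :: s') wt x.
    by apply: perm_big; rewrite -es perm_sym perm_rot.
  rewrite -sz in s5; case: s' s5 sW {es sz} => [|x [|y [|z s']]] //=.
  case/lastP: s' => [|s' w] //= _ sW.
  rewrite /ucycleb /= rcons_path last_rcons => /andP[/and5P[vx _ yz _ wv] _].
  have vW : v \in W by apply: sW; rewrite !inE eqxx.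
  have dv : deg v = 2 by apply/eqP; rewrite -wt_eq0 // v0.
  have xW : x \in W by apply: sW; rewrite !inE eqxx ?orbT.
  have yW : y \in W by apply: sW; rewrite !inE eqxx ?orbT.
  have zW : z \in W by apply: sW; rewrite !inE eqxx ?orbT.
  have wW : w \in W by apply: sW; rewrite !inE mem_rcons inE eqxx ?orbT.
  have wx : wt x = 4 by apply/wt_big/(deg2_nbr vW).
  have ww : wt w = 4 by apply/wt_big/(deg2_nbr vW); rewrite // adj_sym.
  have := wt_adj yW zW yz.
  rewrite !big_cons big_rcons /= wx ww.
  by move: (wt v) (wt y) (wt z) (\sum_(i <- _) _); clear=> *; lia.
have {}pos x : x \in s -> 0 < wt x by move=> /pos; rewrite lt0n.
case: (ltngtP 5 (size s)) s5 => // s5 _.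
  apply: (@leq_trans (\sum_(x <- s) 2)).
    by rewrite big_const_seq count_predT iter_addn; lia.
  by rewrite big_seq [X in _ <= X]big_seq; apply: leq_sum => x /pos /wt_gt0.
case: s s5 sW pos ucyc {cyc} => [|x1 [|x2 [|x3 [|x4 [|x5 [|]]]]]] // _ sW pos.
rewrite /ucycleb /= !inE !negb_or !andbT.
case/andP=> /and5P[e12 e23 e34 e45 e51] /and4P[/and4P[n12 n13 n14 n15] /and3P[n23
  n24 n25] /andP[n34 n35] n45].
have h y : y \in [:: x1; x2; x3; x4; x5] -> y \in W /\ 0 < wt y.
  by move=> ys; split; [apply: sW | apply: pos].
have [w1 p1] : x1 \in W /\ 0 < wt x1 by apply: h; rewrite !inE eqxx ?orbT.
have [w2 p2] : x2 \in W /\ 0 < wt x2 by apply: h; rewrite !inE eqxx ?orbT.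
have [w3 p3] : x3 \in W /\ 0 < wt x3 by apply: h; rewrite !inE eqxx ?orbT.
have [w4 p4] : x4 \in W /\ 0 < wt x4 by apply: h; rewrite !inE eqxx ?orbT.
have [w5 p5] : x5 \in W /\ 0 < wt x5 by apply: h; rewrite !inE eqxx ?orbT.
have := wt_path w1 w2 w3 e12 e23 n13 p1 p2 p3.
have := wt_path w2 w3 w4 e23 e34 n24 p2 p3 p4.
have := wt_path w3 w4 w5 e34 e45 n35 p3 p4 p5.
have n41 : x4 != x1 by rewrite eq_sym.
have n52 : x5 != x2 by rewrite eq_sym.
have := wt_path w4 w5 w1 e45 e51 n41 p4 p5 p1.
have := wt_path w5 w1 w2 e51 e12 n52 p5 p1 p2.
rewrite !big_cons big_nil.
by move: (wt x1) (wt x2) (wt x3) (wt x4) (wt x5); clear=> *; lia.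
Qed.

(** Double counting of weighted incidences between vertices and the even sets yields 24 A <= 24 E -
    24 V, against the size of the cover. *)
Lemma planar_has_reducible (R : realType) : planar R G -> girth_at_least 5 G ->
  W != finset.set0 -> False.
Proof.
move=> plane girth W0.
have [T [A [D [cardA cardD coverA evenA]]]] := planar_cycle_cover plane W0.
pose at_ x c := [set E in edges_in W | (x \in E) && (c \in D E)]%SET.
(* The even set of [c] contains a cycle, of weight at least 12, and has at least two edges at each
   vertex of that cycle. *)
have boundary c : c \in A -> 24 <= \sum_(x in W) wt x * #|at_ x c|.
  move=> cA.
  pose e u v := ([set u; v]%SET \in edges_in W) && (c \in D [set u; v]%SET).
  have e_sym : symmetric e by move=> u v; rewrite /e finset.setUC.
  have e_adj u v : e u v -> adj u v by case/andP; rewrite mem_edges_in => /and3P[].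
  have e_irr : irreflexive e by move=> u; apply/negP => /e_adj; rewrite adj_irrefl.
  have eW u v : e u v -> u \in W by case/andP; rewrite mem_edges_in => /and3P[].
  have at2 u v : e u v -> 2 <= #|at_ u c|.
    move=> uv; have : 0 < #|at_ u c|.
      apply/card_gt0P; exists [set u; v]%SET; case/andP: uv => h1 h2.
      by rewrite inE h1 h2 !inE eqxx.
    by have := evenA u c; rewrite -/(at_ u c); case: #|_| => [|[|]].
  have no_leaf u v : e u v -> exists2 z, z != v & e u z.
    move=> uv; have := at2 _ _ uv; rewrite (cardsD1 [set u; v]%SET).
    have uW := eW _ _ uv.
    have -> : [set u; v]%SET \in at_ u c.
      by case/andP: uv => h1 h2; rewrite inE h1 h2 !inE eqxx.
    rewrite add1n ltnS => /card_gt0P[E]; rewrite 2!inE => /andP[nE].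
    rewrite inE => /and3P[EF uE cE].
    have : E \in [set E in edges_in W | u \in E]%SET by rewrite inE EF.
    rewrite edges_at // => /imsetP[z _ eE]; exists z.
      by apply: contraNneq nE => <-; rewrite eE.
    by rewrite /e -eE EF.
  have [x [y exy]] : exists x y, e x y.
    have [E EF cE] := coverA _ cA.
    have [x [y [_ _ eE]]] : exists x y, [/\ adj x y, x != y & E = [set x; y]%SET].
      by apply: edge_pair; move: EF; rewrite inE => /andP[].
    by exists x, y; rewrite /e -eE EF.
  have [s s2 es] := cycle_ex e_sym e_irr no_leaf exy.
  have cyc : is_cycle s.
    case/andP: es => es us; rewrite /is_cycle s2 /ucycleb us andbT.
    exact: sub_cycle es.
  have s_e z : z \in s -> e z (next s z) by case/andP: es => es _;
    apply: next_cycle.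
  have sW : {subset s <= W} by move=> z /s_e /eW.
  apply: (@leq_trans (\sum_(z <- s) wt z * 2)).
    by rewrite -big_distrl /=; have := cycle_wt girth cyc sW; lia.
  case/andP: es => _ us; rewrite big_uniq //=.
  rewrite big_mkcond [X in _ <= X]big_mkcond /=; apply: leq_sum => z _.
  case: ifP => // zs; rewrite sW // leq_mul2l; apply/orP; right.
  exact: at2 (s_e _ zs).
(* Each edge at [x] belongs to at most two of the even sets. *)
have total : 24 * #|A| <= \sum_(x in W) 2 * (wt x * deg x).
  have -> : 24 * #|A| = \sum_(c in A) 24 by rewrite sum_nat_const mulnC.
  apply: (@leq_trans (\sum_(c in A) \sum_(x in W) wt x * #|at_ x c|)).
    by apply: leq_sum => c /boundary.
  rewrite exchange_big /=; apply: leq_sum => x xW.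
  rewrite -big_distrr /= mulnCA leq_mul2l; apply/orP; right.
  rewrite -card_edges_at // mulnC -sum_nat_const.
  apply: (@leq_trans (\sum_(c in A) \sum_(E in [set E in edges_in W | x \in
    E]%SET) (c \in D E))).
    apply: leq_sum => c _; rewrite -sum1_card big_mkcond [X in _ <= X]big_mkcond /=.
    apply: leq_sum => E _; rewrite !inE.
    by case: (E \subset W); case: (x \in E); case: (c \in D E);
      rewrite ?andbF //=; case: ifP.
  rewrite exchange_big /=; apply: leq_sum => E _; apply: leq_trans (cardD E).
  rewrite -sum1_card big_mkcond [X in _ <= X]big_mkcond /=.
  by apply: leq_sum => c _; case: (c \in A); case: (c \in D E).
have : \sum_(x in W) (wt x * deg x + 12) <= \sum_(x in W) 6 * deg x.
  by apply: leq_sum => x /deg_wt.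
rewrite big_split /= sum_nat_const -!big_distrr /= handshake.
rewrite -big_distrr /= in total.
move: total cardA; set S := \sum_(x in W) _ => total cardA h.
by lia.
Qed.

Lemma mad_has_reducible : (mad G < 3%:R)%R -> W != finset.set0 -> False.
Proof.
move=> mad3 W0.
have dense : 3 * #|W| <= 2 * #|edges_in W|.
  rewrite -handshake.
  pose r u := \sum_(v in W | v \in nbrs u) (deg v == 2).
  have r_le u : r u <= deg u.
    rewrite /r [deg u]/deg -sum1_card big_mkcond [X in _ <= X]big_mkcond /=.
    by apply: leq_sum => v _; case: (v \in nbrs u); rewrite ?andbF // andbT;
      case: ifP => //; case: eqP.
  (* Charges are doubled to remain integral: [r u] is what [u] gives away, 1 to each 2-neighbour,
     and a 2-vertex receives 1 from each neighbour. Below degree 6 nothing is given. *)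
  have local u : u \in W -> 6 + r u <= 2 * deg u + deg u * (deg u == 2).
    move=> uW; have := deg_ge2 uW; have := r_le u.
    have [d6|d6] := leqP 6 (deg u); first lia.
    suff -> : r u = 0 by case: eqP; lia.
    rewrite /r big1 // => v /andP[vW]; rewrite inE => /andP[_ uv].
    by case: eqP => // /(deg2_nbr vW uW) h; move: d6; rewrite ltnNge h // adj_sym.
  have : \sum_(u in W) (6 + r u) <= \sum_(u in W) (2 * deg u + deg u * (deg u ==
    2)).
    exact: leq_sum local.
  have e2 : \sum_(u in W) 2 * deg u = 2 * \sum_(u in W) deg u by rewrite big_distrr.
  rewrite [X in X <= _]big_split [X in _ <= X]big_split /= sum_nat_const e2.
  (* The total given equals the total received. *)
  suff -> : \sum_(u in W) r u = \sum_(u in W) deg u * (deg u == 2) by lia.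
  rewrite /r (exchange_big_dep (fun v => v \in W)) /=; last by move=> u v _ /andP[].
  apply: eq_bigr => u uW; rewrite -[RHS]/(#|nbrs u| * (deg u == 2)) -sum_nat_const.
  apply: eq_bigl => v.
  by rewrite uW /=; case vW: (v \in W);
    [rewrite nbrs_sym | rewrite [v \in nbrs u]inE vW].
have cW : 0 < #|W| by rewrite card_gt0.
have sub : is_subgraph (W, edges_in W).
  apply/andP; split; first by apply/fintype.subsetP => E /=; rewrite inE => /andP[].
  by apply/forall_inP => E /=; rewrite inE => /andP[].
have /bigmax_ltP[_ /(_ (W, edges_in W))] := mad3.
rewrite sub W0 /= ltr_pdivrMr ?ltr0n // -natrM ltr_nat => /(_ isT).
by rewrite ltnNge dense.
Qed.

End Degrees.

(** * Extending colourings *)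

Section Coloring.

Variable G : sgraph.
Implicit Types (W : {set G}) (c : G -> nat).

Definition acyclic_on W c :=
  {in W &, forall u v, adj u v -> c u != c v} /\
  forall (s : seq G) (a b : nat), is_cycle s -> {subset s <= W} ->
    ~~ all (fun v => (c v == a) || (c v == b)) s.

Definition recolor c v k u := if u == v then k else c u : nat.

(** When [x] shares its colour with another neighbour of [v], avoiding these colours at [v] rules
    out two-coloured cycles through [v] and both of them. *)
Definition seen W c v x := [seq c y | y <- enum (nbrs W x :\ v)%SET].

Lemma mem_seen W c v x y : y \in W -> adj x y -> y != v -> c y \in seen W c v x.
Proof. by move=> yW xy yv; apply: map_f; rewrite mem_enum !inE yv yW. Qed.

Lemma size_seen W c v x : v \in W -> x \in nbrs W v ->
  size (seen W c v x) = (deg W x).-1.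
Proof.
move=> vW xv; rewrite size_map -cardE /deg (cardsD1 v (nbrs W x)).
by rewrite nbrs_sym ?xv //; move: xv; rewrite inE => /andP[].
Qed.

(* A two-coloured cycle through [v] enters and leaves [v] through neighbours of
   the same colour, both of which have another neighbour coloured like [v]. *)
Lemma acyclic_extend W c v (k : nat) : v \in W -> acyclic_on (W :\ v)%SET c ->
  (forall x, x \in nbrs W v -> k != c x) ->
  (forall x y, x \in nbrs W v -> y \in nbrs W v -> x != y -> c x = c y ->
    (k \notin seen W c v x) \/ (k \notin seen W c v y)) ->
  acyclic_on W (recolor c v k).
Proof.
move=> vW [proper acyc] fresh unseen.
have nbv u : u \in W -> adj v u -> u \in nbrs W v by move=> uW uv; rewrite inE uW.
have proper' : {in W &, forall u w, adj u w -> recolor c v k u != recolor c v k w}.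
  move=> u w uW wW uw; rewrite /recolor.
  case: (eqVneq u v) => [uv|uv]; case: (eqVneq w v) => [wv|wv].
  - by rewrite uv wv adj_irrefl in uw.
  - by apply/fresh/nbv; rewrite // -uv.
  - by rewrite eq_sym; apply/fresh/nbv; rewrite // -wv adj_sym.
  - by apply: proper => //; rewrite !inE ?uv ?wv.
split=> // s a b cyc sW; apply/negP => /allP bi.
have [vs|vs] := boolP (v \in s); last first.
  have sv x : x \in s -> x != v by apply: contraTneq => ->.
  have sWv : {subset s <= (W :\ v)%SET} by move=> x xs; rewrite !inE sv // sW.
  case/negP: (acyc s a b cyc sWv); apply/allP => x xs.
  by have := bi x xs; rewrite /recolor (negbTE (sv x xs)).
have [i s' es] := rot_to vs.
have /andP[s3 ucyc] := cyc.
have : ucycleb (@adj G) (v :: s') by rewrite -es /ucycleb rot_cycle rot_uniq.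
have {}s3 : 2 < size (v :: s') by rewrite -es size_rot.
have {}sW x : x \in v :: s' -> x \in W by rewrite -es mem_rot => /sW.
have {}bi x : x \in v :: s' -> (recolor c v k x == a) || (recolor c v k x == b).
  by rewrite -es mem_rot => /bi.
(* The cycle is written as [v], [x], [m], [z], so that [x] and [z] are the neighbours of [v] on
   it. *)
case: s' s3 sW bi {es cyc} => [|x s'] // s3 sW bi.
case/lastP: s' s3 sW bi => [|m z] // _ sW bi.
have /= := bi v (mem_head _ _); rewrite {1 2}/recolor eqxx => kab.
rewrite /ucycleb => /andP[]; rewrite (cycle_path v) /= !rcons_path !last_rcons.
move=> /andP[zv] /andP[vx] /andP[pm zlast] /andP[vn /andP[xn _]].
have col u : u \in x :: rcons m z -> recolor c v k u = c u.
  by move=> us; rewrite /recolor; case: eqP => // uv; rewrite -uv us in vn.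
have bi' u : u \in x :: rcons m z -> (c u == a) || (c u == b).
  by move=> us; rewrite -col //; apply: bi; rewrite inE us orbT.
have sW' u : u \in x :: rcons m z -> u \in W by move=> us; apply: sW;
  rewrite inE us orbT.
have xs : x \in x :: rcons m z by rewrite mem_head.
have zs : z \in x :: rcons m z by rewrite inE mem_rcons mem_head orbT.
have xv : x \in nbrs W v by rewrite nbv // sW'.
have zv' : z \in nbrs W v by rewrite nbv 1?adj_sym // sW'.
have xz : x != z by apply: contraNneq xn => ->; rewrite mem_rcons mem_head.
have same : c x = c z.
  have := bi' _ xs; have := bi' _ zs; have := fresh _ xv; have := fresh _ zv'.
  by case/orP: kab => /eqP -> => /negbTE + /negbTE;
     rewrite ![_ == c _]eq_sym => -> ->; rewrite ?orbF => /eqP -> /eqP ->.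
have seenk u w : u \in nbrs W v -> u \in x :: rcons m z -> w \in x :: rcons m z ->
    adj u w -> k \in seen W c v u.
  move=> uv us ws uw.
  have <- : c w = k.
    have := proper' _ _ (sW' _ us) (sW' _ ws) uw; rewrite !col //.
    have := bi' _ us; have := bi' _ ws; have := fresh _ uv.
    move: (c u) (c w) kab => p q; clear.
    by lia.
  apply: mem_seen => //; first exact: sW'.
  by apply: contraNneq vn => <-.
have xk : k \in seen W c v x.
  have [y ys xy] : exists2 y, y \in rcons m z & adj x y.
    move: pm zlast; case: (m) => [|y m'] /=; first by exists z; rewrite ?mem_head.
    by case/andP=> xy _ _; exists y; rewrite ?mem_head.
  by apply: (seenk x y); rewrite // inE ys orbT.
have zk : k \in seen W c v z.
  apply: (seenk z (last x m)) => //; last by rewrite adj_sym.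
  by rewrite -cats1 -cat_cons mem_cat mem_last.
by case: (unseen x z xv zv' xz same) => /negP.
Qed.

Lemma fresh_color (L : {fset nat}) (s : seq nat) : size s < #|` L| ->
  exists2 k, k \in L & k \notin s.
Proof.
move=> h; apply: contrapT => no; move: h; rewrite ltnNge => /negP; apply.
apply: uniq_leq_size (fset_uniq L) _ => k kL.
by apply: contrapT => /negP ks; apply: no; exists k.
Qed.

(** The list [f] holds the colours of the neighbours of [v] and, for each coincidence among them,
    the colours seen from one of the two. It has at most five entries, fewer than the list of
    [v]. *)
Lemma reducible_extend W c v (L : {fset nat}) : v \in W -> #|` L| = 6 ->
  reducible W v ->
  acyclic_on (W :\ v)%SET c -> exists2 k, k \in L & acyclic_on W (recolor c v k).
Proof.
move=> vW L6 red ok.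
have [f [szf cf sf]] : exists f : seq nat, [/\ size f < 6,
    forall x, x \in nbrs W v -> c x \in f
  & forall x y, x \in nbrs W v -> y \in nbrs W v -> x != y -> c x = c y ->
    {subset seen W c v x <= f} \/ {subset seen W c v y <= f}]; last first.
  rewrite -L6 in szf; have [k kL kf] := fresh_color szf; exists k => //.
  apply: acyclic_extend => // [x xv|x y xv yv xy cxy].
    by apply: contraNneq kf => ->; apply: cf.
  by case: (sf x y xv yv xy cxy) => h; [left|right]; apply: contra kf => /h.
case: red => [d1|[d2 [x xv dx]]|[d3 [x [y [xv yv xy dx dy]]]]].
- exists [seq c x | x <- enum (nbrs W v)]; split.
  + by rewrite size_map -cardE; apply: leq_ltn_trans d1 _.
  + by move=> x xv; apply: map_f; rewrite mem_enum.
  + by move=> x y xv yv; rewrite (card_le1_eqP d1 x y xv yv) eqxx.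
- have [y eN] : exists y, nbrs W v = [set x; y]%SET.
    have : #|(nbrs W v :\ x)%SET| == 1 by move: d2;
      rewrite /deg (cardsD1 x) xv add1n => -[->].
    by case/cards1P=> y ey; exists y; rewrite -(finset.setD1K xv) ey.
  (* Either two different colours, or one colour and at most four seen from [x], whose degree is at
     most 5. *)
  exists (undup [:: c x; c y] ++ if c x == c y then seen W c v x else [::]); split.
  + have := size_seen c vW xv => sx; rewrite size_cat /= inE.
    by case: eqP => _ /=; rewrite ?sx //; case: (deg W x) dx => // d; rewrite ltnS.
  + move=> u; rewrite eN !inE mem_cat mem_undup !inE.
    by case/orP=> /eqP ->; rewrite eqxx ?orbT.
  + move=> p q; rewrite eN !inE => /orP[]/eqP -> /orP[]/eqP ->;
    rewrite ?eqxx // => _ e.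
      by left=> k ks; rewrite e eqxx mem_cat -?e ks orbT.
    by right=> k ks; rewrite -e eqxx mem_cat ?e ks orbT.
- have [z eN] : exists z, nbrs W v = [set x; y; z]%SET.
    have yx : y \in (nbrs W v :\ x)%SET by rewrite !inE eq_sym xy; move: yv;
      rewrite inE.
    have : #|(nbrs W v :\ x :\ y)%SET| == 1.
      by move: d3; rewrite /deg (cardsD1 x) xv (cardsD1 y) yx !add1n => -[->].
    case/cards1P=> z ez; exists z.
    by rewrite -(finset.setD1K xv) -(finset.setD1K yx) ez finset.setUA.
  (* Coincidences with [x] are handled at [x] and the one of [y] with [z] at [y], so the degree of
     [z] does not matter. Both 3-vertices see two colours besides that of [v]; the worst case is 1 +
     2 + 2. *)
  exists (undup [:: c x; c y; c z] ++
          (if (c x == c y) || (c x == c z) then seen W c v x else [::]) ++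
          (if c y == c z then seen W c v y else [::])); split.
  + have := size_seen c vW xv; have := size_seen c vW yv; rewrite dx dy => sy sx.
    rewrite !size_cat /= !inE.
    case: (c x =P c y) => h1; case: (c x =P c z) => h2; case: (c y =P c z) => h3;
      rewrite /= ?sx ?sy //; congruence.
  + move=> u; rewrite eN !inE mem_cat mem_undup !inE -orbA.
    by case/or3P=> /eqP ->; rewrite eqxx ?orbT.
  + have hx : (c x == c y) || (c x == c z) -> {subset seen W c v x <=
        undup [:: c x; c y; c z] ++
          (if (c x == c y) || (c x == c z) then seen W c v x else [::]) ++
          (if c y == c z then seen W c v y else [::])}.
      by move=> -> k ks; rewrite !mem_cat ks !orbT.
    have hy : c y == c z -> {subset seen W c v y <=
        undup [:: c x; c y; c z] ++
          (if (c x == c y) || (c x == c z) then seen W c v x else [::]) ++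
          (if c y == c z then seen W c v y else [::])}.
      by move=> -> k ks; rewrite !mem_cat ks !orbT.
    move=> p q; rewrite eN !inE -!orbA => /or3P[]/eqP -> /or3P[]/eqP ->;
      rewrite ?eqxx // => _ e.
    * by left; apply: hx; rewrite e eqxx.
    * by left; apply: hx; rewrite e eqxx orbT.
    * by right; apply: hx; rewrite e eqxx.
    * by left; apply: hy; rewrite e.
    * by right; apply: hx; rewrite e eqxx orbT.
    * by right; apply: hy; rewrite e.
Qed.

Lemma acyclic_list_coloring (L : G -> {fset nat}) :
  (forall v, #|` L v| = 6) ->
  (forall W, W != finset.set0 -> exists2 v, v \in W & reducible W v) ->
  forall W, exists2 c, {in W, forall v, c v \in L v} & acyclic_on W c.
Proof.
move=> L6 red W; move: {2}#|W| (erefl #|W|) => n; elim: n W => [|n IH] W cW.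
  move/eqP: cW; rewrite cards_eq0 => /eqP ->; exists (fun=> 0).
    by move=> v; rewrite inE.
  split=> [u v|s a b /andP[s2 _] sW]; first by rewrite inE.
  case: s s2 sW => // x s _ sW.
  by have := sW x (mem_head _ _); rewrite inE.
have [v vW vred] : exists2 v, v \in W & reducible W v.
  by apply: red; rewrite -cards_eq0 cW.
have [|c cL ok] := IH (W :\ v)%SET; first by move: cW;
  rewrite (cardsD1 v) vW => -[].
have [k kL ok'] := reducible_extend vW (L6 v) vred ok.
exists (recolor c v k) => // u uW; rewrite /recolor;
  case: (eqVneq u v) => [->//|uv].
by apply: cL; rewrite !inE uv.
Qed.

End Coloring.

Theorem theorem7p4 (R : realType) (G : sgraph) :
  (planar R G /\ girth_at_least 5 G) \/ (mad G < 3%:R)%R ->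
  acyclic_list_number G <= 6.
Proof.
move=> sparse; rewrite /acyclic_list_number; case: ex_minnP => k _ min_k.
apply: min_k; apply/asboolP => L L6.
have red (W : {set G}) : W != finset.set0 -> exists2 v, v \in W & reducible W v.
  move=> W0; apply: contrapT => no.
  have irr v : v \in W -> ~ reducible W v by move=> vW rv; apply: no; exists v.
  case: sparse => [[plane girth]|mad3].
    exact: (planar_has_reducible irr plane girth W0).
  exact: (mad_has_reducible irr mad3 W0).
have [c cL [proper acyc]] := acyclic_list_coloring L6 red [set: G]%SET.
exists c => [v|]; first by apply: cL; rewrite inE.
split=> [u v|s a b cyc]; first by apply: proper; rewrite inE.
by apply: acyc => // x _; rewrite inE.
Qed.
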